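(* Let $(a,b)\in\mathcal H$ and let $\phi_{a,b}:K^2\to K^2$ be the associated Hénon map. (a) $J(\phi_{a,b})$ is compact. It is empty if and only if $(a,b)\in\mathcal H_{\mathrm{III}}$ and $a$ is not a square in $K$. (b) $(a,b)\in\mathcal H_{\mathrm I}$ if and only if $J(\phi_{a,b})$ is equal to the closed unit ball $B_1(0,0)$. (c) If $(a,b)\in\mathcal H_{\mathrm I}\cup\mathcal H_{\mathrm{II}}^+$, then $J(\phi_{a,b})$ is equal to the set of recurrent points of $\phi_{a,b}$. (d) If $(a,b)\in\mathcal H_{\mathrm{II}}^+$, then $J(\phi_{a,b})$ is an attractor for $\phi_{a,b}$. (e) If $(a,b)\in\mathcal H_{\mathrm{III}}$ and $a$ is a square in $K$, then the restriction of $\phi_{a,b}$ to $J(\phi_{a,b})$ is topologically conjugate to the two-sided shift map on the space of bisequences in two symbols.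
   Context: $K$ is a field complete and locally compact with respect to a nontrivial non-Archimedean absolute value $|\cdot|$, whose residue field has odd characteristic. $K^2$ carries the norm $\|(x,y)\|=\max(|x|,|y|)$, and $B_r(c_1,c_2)=\{(x,y)\in K^2:\|(x,y)-(c_1,c_2)\|\le r\}$. The parameter space is $\mathcal H=\{(a,b)\in K^2: b\neq 0\}$; for $(a,b)\in\mathcal H$ the Hénon map is $\phi_{a,b}(x,y)=(a+by-x^2,x)$, a bijection of $K^2$ with inverse $\phi_{a,b}^{-1}(x,y)=(y,\frac1b(-a+x+y^2))$; $\phi^n$ denotes the $n$-th iterate for $n\in\mathbb Z$. Define $J^+(\phi_{a,b})$ (resp. $J^-(\phi_{a,b})$) as the set of $(x,y)\in K^2$ with $\|\phi_{a,b}^n(x,y)\|$ bounded as $n\to+\infty$ (resp. $n\to-\infty$), and $J(\phi_{a,b})=J^+(\phi_{a,b})\cap J^-(\phi_{a,b})$. Regions: $\mathcal H_{\mathrm I}=\{|a|\le1,|b|=1\}$, $\mathcal H_{\mathrm{II}}^+=\{|a|\le1,|b|<1\}$, $\mathcal H_{\mathrm{II}}^-=\{|a|\le|b|^2,|b|>1\}$, $\mathcal H_{\mathrm{III}}=\{|a|>\max(1,|b|^2)\}$ (all within $\mathcal H$). A point $\alpha$ is recurrent for a continuous self-map $\phi$ of a metric space if for every open neighborhood $U$ of $\alpha$ there is $n\ge1$ with $\phi^n(\alpha)\in U$. For a homeomorphism $\phi$ of a metric space $(M,d)$, an attractor is a set $\mathcal A\subseteq M$ that is nonempty, compact, satisfies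 $\phi(\mathcal A)=\mathcal A$, and such that there exists an open set $U\subseteq M$ properly containing $\mathcal A$ with $\lim_{n\to+\infty}\min_{\alpha\in\mathcal A}d(\phi^n(\beta),\alpha)=0$ for all $\beta\in U$. The two-sided shift: $\{\pm\}^{\mathbb Z}$ is the set of bisequences $(s_k)_{k\in\mathbb Z}$ with $s_k\in\{+,-\}$, with metric $d(s,s')=e^{-\min\{|k|: s_k\neq s'_k\}}$, and $\sigma(s)_k=s_{k+1}$; topological conjugacy means there is a homeomorphism $\omega:\{\pm\}^{\mathbb Z}\to J(\phi_{a,b})$ with $\omega\circ\sigma=\phi_{a,b}\circ\omega$. *)

(* Defs.v *)
From HB Require Import structures.
From mathcomp Require Import all_boot all_order all_algebra.
From mathcomp Require Import ring_quotient.
From mathcomp Require Import all_classical all_reals all_analysis.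

Set Implicit Arguments.
Unset Strict Implicit.
Unset Printing Implicit Defensive.

Import Order.TTheory GRing.Theory Num.Theory.
Import numFieldNormedType.Exports.

Local Open Scope classical_set_scope.
Local Open Scope ring_scope.

Record nonArchAbs (R : realType) (K : fieldType) := NonArchAbs {
  absval :> K -> R;
  absval_ge0 : forall x, 0 <= absval x;
  absval_eq0 : forall x, absval x = 0 <-> x = 0;
  absvalM : forall x y, absval (x * y) = absval x * absval y;
  absvalD : forall x y, absval (x + y) <= Num.max (absval x) (absval y)
}.

(* The field K with the topology defined by the absolute value v.  The library's
   normed Z-modules cannot be used here: they require |n x| = n |x| for every
   natural number n, which fails for non-Archimedean absolute values. *)
Definition valued (R : realType) (K : fieldType) (v : nonArchAbs R K) : Type := K.

Section Valued.
Variables (R : realType) (K : fieldType) (v : nonArchAbs R K).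
Implicit Types x y : K.

Lemma absval0 : v 0 = 0.
Proof. exact/absval_eq0. Qed.

Lemma absval1 : v 1 = 1.
Proof.
have n1 : v 1 != 0 by apply: contra_neq (oner_neq0 K) => /absval_eq0.
by apply: (mulfI n1); rewrite -absvalM !mulr1.
Qed.

Lemma absvalN x : v (- x) = v x.
Proof.
have vN1 : v (-1) = 1.
  have : v (-1) ^+ 2 = 1 by rewrite expr2 -absvalM mulrNN mulr1 absval1.
  by move/eqP; rewrite sqrp_eq1 ?absval_ge0// => /eqP.
by rewrite -mulN1r absvalM vN1 mul1r.
Qed.

HB.instance Definition _ := GRing.Field.copy (valued v) K.
HB.instance Definition _ := isPointed.Build (valued v) 0.

Definition abs_mdist x y : R := v (x - y).

Lemma abs_mdistxx x : abs_mdist x x = 0.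
Proof. by rewrite /abs_mdist subrr absval0. Qed.

Lemma abs_mdist_positivity x y : abs_mdist x y = 0 -> x = y.
Proof. by move/absval_eq0/eqP; rewrite subr_eq0 => /eqP. Qed.

Lemma abs_mdist_sym x y : abs_mdist x y = abs_mdist y x.
Proof. by rewrite /abs_mdist -absvalN opprB. Qed.

Lemma abs_mdist_triangle y x z :
  abs_mdist x z <= abs_mdist x y + abs_mdist y z.
Proof.
rewrite /abs_mdist -(subrKA y); apply: le_trans (absvalD _ _ _) _.
by rewrite ge_max lerDl lerDr !absval_ge0.
Qed.

HB.instance Definition _ := isMetric.Build R (valued v)
  abs_mdistxx abs_mdist_positivity abs_mdist_sym abs_mdist_triangle.

End Valued.

Definition complete_space (T : puniformType) : Prop :=
  forall F : set_system T, ProperFilter F -> cauchy F -> cvg F.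

(* Products carry the distance whose balls are products of balls, as in the
   library's pseudometric structure on them. *)
Section ProdMetric.
Variables (R : realType) (X Y : metricType R).
Implicit Types p q : X * Y.

Definition prod_mdist p q : R := Num.max (mdist p.1 q.1) (mdist p.2 q.2).

Lemma prod_mdist_ge0 p q : 0 <= prod_mdist p q.
Proof. by rewrite le_max mdist_ge0. Qed.

Lemma prod_mdist_positivity p q : prod_mdist p q = 0 -> p = q.
Proof.
move=> pq0; have : prod_mdist p q <= 0 by rewrite pq0.
rewrite ge_max => /andP[d1 d2].
rewrite [p]surjective_pairing [q]surjective_pairing.
by congr pair; apply: mdist_positivity; apply/eqP; rewrite eq_le mdist_ge0 andbT.
Qed.

Lemma prod_ballEmdist p d : ball p d = [set q | prod_mdist p q < d].
Proof.
apply/seteqP; split=> q; rewrite /ball /= /prod_ball !ballEmdist /= gt_max.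
  by case=> -> ->.
by move/andP.
Qed.

HB.instance Definition _ := PseudoMetric_isMetric.Build R (X * Y)%type
  prod_mdist_ge0 prod_mdist_positivity prod_ballEmdist.

End ProdMetric.

Section ResidueField.
Variables (R : realType) (K : fieldType) (v : nonArchAbs R K).

Definition integral : {pred K} := fun x => v x <= 1.

Lemma integral_subring_closed : subring_closed integral.
Proof.
split=> [|x y|x y]; rewrite !unfold_in.
- by rewrite absval1.
- move=> x1 y1; apply: le_trans (absvalD _ _ _) _.
  by rewrite ge_max x1 absvalN y1.
- by move=> x1 y1; rewrite absvalM mulr_ile1 ?absval_ge0.
Qed.

HB.instance Definition _ :=
  GRing.isSubringClosed.Build K integral integral_subring_closed.

Record valuation_ring := ValuationRing {
  vr_val : K;
  _ : vr_val \in integral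
}.

HB.instance Definition _ := [isSub for vr_val].
HB.instance Definition _ := [Choice of valuation_ring by <:].
HB.instance Definition _ :=
  [SubChoice_isSubComNzRing of valuation_ring by <:].

Definition maximal_ideal : {pred valuation_ring} :=
  fun x => v (vr_val x) < 1.

Lemma maximal_ideal_closed : idealr_closed maximal_ideal.
Proof.
have val0 : vr_val 0 = 0 := rmorph0 (val : valuation_ring -> K).
have val1 : vr_val 1 = 1 := rmorph1 (val : valuation_ring -> K).
split; rewrite ?unfold_in /maximal_ideal.
- by rewrite val0 absval0.
- by rewrite val1 absval1 ltxx.
move=> a u w; rewrite !unfold_in /maximal_ideal => u1 w1.
have -> : vr_val (a * u + w) = vr_val a * vr_val u + vr_val w.
  have := rmorphD (val : valuation_ring -> K) (a * u) w.
  by rewrite rmorphM.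
apply: le_lt_trans (absvalD _ _ _) _; rewrite gt_max w1 andbT absvalM.
have a1 : v (vr_val a) <= 1 by exact: (valP a).
by apply: le_lt_trans u1; rewrite ler_piMl ?absval_ge0.
Qed.

HB.instance Definition _ :=
  isIdealr.Build valuation_ring maximal_ideal maximal_ideal_closed.

Definition residue_field := {ideal_quot maximal_ideal}.
HB.instance Definition _ := GRing.ComNzRing.on residue_field.

End ResidueField.

Section Henon.
Variables (R : realType) (K : fieldType) (v : nonArchAbs R K).
Local Notation Kv := (valued v).
Implicit Types (a b : Kv) (p q : Kv * Kv).

Definition henon a b p : Kv * Kv := (a + b * p.2 - p.1 ^+ 2, p.1).

Definition henon_inv a b p : Kv * Kv := (p.2, b^-1 * (- a + p.1 + p.2 ^+ 2)).

Lemma henonK a b : b != 0 -> cancel (henon a b) (henon_inv a b).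
Proof.
move=> b0 [x y]; rewrite /henon /henon_inv /=; congr pair.
by rewrite -[- a + _ + _]addrA subrK addKr mulKf.
Qed.

Lemma henon_invK a b : b != 0 -> cancel (henon_inv a b) (henon a b).
Proof.
move=> b0 [x y]; rewrite /henon /henon_inv /=; congr pair.
by rewrite mulVKf// addrA addrK addNKr.
Qed.

Definition henon_iter a b (n : int) : Kv * Kv -> Kv * Kv :=
  match n with
  | Posz m => iter m (henon a b)
  | Negz m => iter m.+1 (henon_inv a b)
  end.

Definition norm2 p : R := Num.max (v p.1) (v p.2).

Lemma mdist_norm2 p q : mdist p q = norm2 (p - q).
Proof. by []. Qed.

Definition julia_plus a b : set (Kv * Kv) :=
  [set p | exists M : R, forall n : nat, norm2 (henon_iter a b n%:Z p) <= M].

Definition julia_minus a b : set (Kv * Kv) :=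
  [set p | exists M : R, forall n : nat, norm2 (henon_iter a b (- n%:Z) p) <= M].

Definition julia a b : set (Kv * Kv) := julia_plus a b `&` julia_minus a b.

Definition henon_param : set (Kv * Kv) := [set c | c.2 != 0].

Definition region_I : set (Kv * Kv) :=
  henon_param `&` [set c | v c.1 <= 1 /\ v c.2 = 1].

Definition region_II_plus : set (Kv * Kv) :=
  henon_param `&` [set c | v c.1 <= 1 /\ v c.2 < 1].

Definition region_III : set (Kv * Kv) :=
  henon_param `&` [set c | Num.max 1 (v c.2 ^+ 2) < v c.1].

(* closed_ball is the closure of the open ball, which over a non-Archimedean
   field is in general smaller than the ball of points at distance <= r;
   closed_ball_ is the latter. *)
Definition cball (r : R) (c : Kv * Kv) : set (Kv * Kv) := closed_ball_ norm2 c r.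

End Henon.

Arguments henon_param {R K} v.
Arguments region_I {R K} v.
Arguments region_II_plus {R K} v.
Arguments region_III {R K} v.
Arguments cball {R K} v.

Definition recurrent (T : topologicalType) (f : T -> T) (x : T) : Prop :=
  forall U : set T, open U -> U x -> exists n : nat, (0 < n)%N /\ U (iter n f x).

Section Attractor.
Variables (R : realType) (M : metricType R).

(* For nonempty compact A this infimum is attained: it is the minimum of the
   distances from x to the points of A. *)
Definition dist_to (A : set M) (x : M) : R := inf [set mdist x y | y in A].

Definition attractor (f : M -> M) (A : set M) : Prop :=
  [/\ A !=set0, compact A, f @` A = A &
    exists U : set M, [/\ open U, A `<` U &
      forall x, U x -> dist_to A (iter n f x) @[n --> \oo] --> (0 : R)]].

End Attractor.

(* Bisequences of signs, true standing for + and false for -.  The phantom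
   parameter R is the field in which distances take their values. *)
Definition bisequence (R : realType) : Type := int -> bool.

HB.instance Definition _ (R : realType) := gen_eqMixin (bisequence R).
HB.instance Definition _ (R : realType) := gen_choiceMixin (bisequence R).

Section Bisequence.
Variable R : realType.
Implicit Types s t u : bisequence R.

Definition disagree s t : pred nat :=
  fun n => `[< exists k : int, `|k|%N = n /\ s k <> t k >].

Definition bidist s t : R :=
  if pselect (exists n, disagree s t n) is left h
  then expR (- (ex_minn h)%:R) else 0.

Lemma bidistxx s : bidist s s = 0.
Proof.
rewrite /bidist; case: pselect => // h; exfalso.
by case: h => n /asboolP[k [_]]; apply.
Qed.

Lemma bidist_ge0 s t : 0 <= bidist s t.
Proof. by rewrite /bidist; case: pselect => // h; exact: expR_ge0. Qed.

Lemma bidist_eq0 s t : bidist s t = 0 -> s = t.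
Proof.
rewrite /bidist; case: pselect => [h /eqP|h _]; first by rewrite gt_eqF ?expR_gt0.
apply/funext => k; apply: contrapT => stk; apply: h.
by exists `|k|%N; apply/asboolP; exists k.
Qed.

Lemma bidist_sym s t : bidist s t = bidist t s.
Proof.
have E : disagree s t = disagree t s.
  apply/funext => n; apply/asbool_equiv_eq.
  by split=> -[k [kn st]]; exists k; split=> // e; apply: st.
by rewrite /bidist E.
Qed.

Lemma bidist_ultra t s u : bidist s u <= Num.max (bidist s t) (bidist t u).
Proof.
rewrite {1}/bidist; case: pselect => [h|_]; last first.
  by rewrite le_max bidist_ge0.
case: ex_minnP => n /asboolP[k [kn suk]] _.
have le_dist v w : v k <> w k -> expR (- n%:R) <= bidist v w.
  move=> vw; have vwn : disagree v w n by apply/asboolP; exists k.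
  rewrite /bidist; case: pselect => [h'|]; last by case; exists n.
  case: ex_minnP => m _ /(_ n vwn) mn.
  by rewrite ler_expR lerN2 ler_nat.
rewrite le_max; have [stk|stk] := eqVneq (s k) (t k).
  by rewrite orbC le_dist// -stk.
by rewrite le_dist//; apply/eqP.
Qed.

Lemma bidist_triangle t s u : bidist s u <= bidist s t + bidist t u.
Proof.
apply: le_trans (bidist_ultra t s u) _.
by rewrite ge_max lerDl lerDr !bidist_ge0.
Qed.

HB.instance Definition _ := isMetric.Build R (bisequence R)
  bidistxx bidist_eq0 bidist_sym bidist_triangle.

Definition two_sided_shift s : bisequence R := fun k => s (k + 1).

End Bisequence.

Definition homeomorphism (X Y : topologicalType) (f : X -> Y) : Prop :=
  continuous f /\
  exists g : Y -> X, [/\ cancel f g, cancel g f & continuous g].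

(* The set A, seen as a type by coercion, carries the topology induced by Y. *)
Definition conjugate_to_restriction (X Y : topologicalType)
    (f : X -> X) (g : Y -> Y) (A : set Y) : Prop :=
  exists w : X -> A, homeomorphism w /\
    forall x, set_val (w (f x)) = g (set_val (w x)).

(* Main.v *)
(* If r >= 1, r >= |b| and r^2 >= |a|, a point of norm > r escapes to infinity
   under forward iteration when |x| >= |y| and under backward iteration when
   |y| >= |x|.  Hence J is the set of points whose whole orbit stays in the ball
   of radius r, which is compact.  When phi or its inverse maps such a ball into
   itself, limit points of orbits lie in J; this gives nonemptiness outside
   region III and the attractor in region II+.  For |a|, |b| <= 1 the map is
   nonexpanding on the unit ball, so two close points of a backward orbit in J,
   pushed forward, show that every point of J is recurrent.
   In region III a point of J is a bounded solution (x_k) of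
   x_k^2 = a + b x_(k-1) - x_(k+1), where the last two terms are small compared
   with a.  Hence a = c^2 by Newton iteration, each x_k is close to exactly one
   of c and -c, and for every choice of signs simultaneous Newton iteration in all
   the x_k is a contraction: every sign
   sequence is realized by exactly one point of J. *)

Require Import Defs.
From mathcomp Require Import all_boot all_order all_algebra.
From mathcomp Require Import ring_quotient zify ring.
From mathcomp Require Import all_classical all_reals all_analysis.

Set Implicit Arguments.
Unset Strict Implicit.
Unset Printing Implicit Defensive.

Import Order.TTheory GRing.Theory Num.Theory.

Import numFieldNormedType.Exports.
Local Open Scope classical_set_scope.
Local Open Scope ring_scope.

(** * Integer indices, iterates and geometric sequences *)

Lemma absz_pred_add_le (k : int) (m n : nat) :
  (`|k| + m.+1 <= n)%N -> (`|(k - 1)%R| + m <= n)%N.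
Proof. lia. Qed.

Lemma absz_succ_add_le (k : int) (m n : nat) :
  (`|k| + m.+1 <= n)%N -> (`|(k + 1)%R| + m <= n)%N.
Proof. lia. Qed.

Lemma absz_eq_cases (k : int) (n : nat) : `|k|%N = n -> k = n%:Z \/ k = - n%:Z.
Proof. lia. Qed.

Lemma iter_cancel (T : Type) (f g : T -> T) (n : nat) :
  cancel f g -> cancel (iter n f) (iter n g).
Proof. by move=> fK; elim: n => // n IH x; rewrite iterSr /= fK IH. Qed.

Lemma continuous_iter (T : topologicalType) (f : T -> T) (n : nat) :
  continuous f -> continuous (iter n f).
Proof.
move=> cf; elim: n => [x|n IH x]; first exact: cvg_id.
exact: (continuous_comp (IH x) (cf _)).
Qed.

Lemma exprn_cvg0 (R : realType) (l c e : R) :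
  0 <= l < 1 -> 0 < e -> exists n : nat, l ^+ n * c < e.
Proof.
move=> /andP[l0 l1] e0.
have : (fun n : nat => l ^+ n * c) @ \oo --> (0 : R^o).
  by rewrite -(mul0r c); apply: cvgMl; apply: cvg_expr; rewrite ger0_norm.
move/cvgrPdist_lt => /(_ e e0)[n _ /(_ n (leqnn n))] /=.
by rewrite sub0r normrN => h; exists n; apply: le_lt_trans h; exact: ler_norm.
Qed.

Lemma geometric_unbounded (R : realType) (t c M : R) :
  1 < t -> 0 < c -> exists n : nat, M < t ^+ n * c.
Proof.
move=> t1 c0; have t0 : 0 < t := lt_trans ltr01 t1.
have [M0|M0] := leP M 0.
  by exists 0%N; rewrite expr0 mul1r (le_lt_trans M0).
have [||n] := @exprn_cvg0 R t^-1 M c; rewrite ?invr_ge0 ?invf_lt1 ?(ltW t0)//.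
by rewrite exprVn mulrC ltr_pdivrMr ?exprn_gt0// mulrC => ?; exists n.
Qed.

(** * Cluster points of orbits in compact sets *)

Section Compactness.
Variable T : topologicalType.
Implicit Types (A B : set T) (f g : T -> T).

Lemma compact_seq_cluster A (u : nat -> T) : compact A -> (forall n, A (u n)) ->
  exists2 z, A z &
    forall U, nbhs z U -> forall N, exists2 n, (N <= n)%N & U (u n).
Proof.
move=> cA Au; have uA : (u @ \oo) A by exists 0%N => // n _; exact: Au.
have [z [Az clz]] := cA _ _ uA.
exists z => // U zU N.
have uN : (u @ \oo) [set u n | n in [set n | (N <= n)%N]].
  by exists N => // n Nn; exists n.
by have [_ [[n Nn <-] Un]] := clz _ _ uN zU; exists n.
Qed.

Lemma omega_limit f g B x (h : nat -> nat) :
  cancel f g -> continuous g -> compact B -> closed B ->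
  (forall y, B y -> B (f y)) -> B x -> (forall n, (n <= h n)%N) ->
  exists z, (forall n, B (iter n g z)) /\
    forall U, nbhs z U -> exists n, U (iter (h n) f x).
Proof.
move=> fK cg cB clB fB Bx hn.
have Bf n y : B y -> B (iter n f y) by move=> By; elim: n => //= n /fB.
have [z _ clz] := compact_seq_cluster cB (fun n => Bf (h n) x Bx).
exists z; split=> [n|U zU]; last by have [n _] := clz U zU 0%N; exists n.
apply: contrapT => nB.
have oB : open ((iter n g) @^-1` (~` B)).
  apply: open_comp; last exact: closed_openC.
  by move=> y _; exact: continuous_iter.
have [m nm] := clz _ (open_nbhs_nbhs (conj oB nB)) n; apply.
rewrite -(subnKC (leq_trans nm (hn m))) iterD iter_cancel//; exact: Bf.
Qed.

End Compactness.

(** * Continuity, closeness and recurrence in metric spaces *)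

Section MetricSpaces.
Variable R : realType.

Lemma nbhs_mdistP (M : metricType R) (x : M) (U : set M) :
  nbhs x U <-> exists2 e : R, 0 < e & forall y, mdist x y < e -> U y.
Proof.
rewrite nbhs_ballP; split=> -[e e0 eU]; exists e => //.
  by move=> y xy; apply: eU; rewrite ballEmdist.
by move=> y; rewrite ballEmdist; exact: eU.
Qed.

(** Made for quadratic maps, whose Lipschitz constant depends on the centre and is controlled only
    at bounded distance from it. *)
Lemma locally_lipschitz_continuous (M N : metricType R) (f : M -> N) :
  (forall x, exists L : R,
     forall y, mdist x y <= 1 -> mdist (f x) (f y) <= L * mdist x y) ->
  continuous f.
Proof.
move=> lf x U /nbhs_mdistP[e e0 eU]; have [L lfx] := lf x.
apply/nbhs_mdistP; pose L' := Num.max 1 L.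
have L0 : 0 < L' by rewrite lt_max ltr01.
exists (Num.min 1 (e / L')); first by rewrite lt_min ltr01 divr_gt0.
move=> y; rewrite lt_min => /andP[xy1 xye]; apply: eU.
apply: (le_lt_trans (lfx y (ltW xy1))).
apply: (@le_lt_trans _ _ (L' * mdist x y)).
  by rewrite ler_wpM2r ?mdist_ge0// le_max lexx orbT.
by rewrite mulrC -ltr_pdivlMr.
Qed.

Lemma compact_seq_close (M : metricType R) (A : set M) (u : nat -> M) (e : R) :
  compact A -> (forall n, A (u n)) -> 0 < e ->
  exists m n, (m < n)%N /\ mdist (u m) (u n) < e.
Proof.
move=> cA Au e0; have [z _ clz] := compact_seq_cluster cA Au.
have zU : nbhs z (ball z (e / 2)) by apply: nbhsx_ballx; rewrite divr_gt0.
have [m _ zm] := clz _ zU 0%N; have [n mn zn] := clz _ zU m.+1.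
exists m, n; split => //.
have := ball_splitr zm zn; by rewrite ballEmdist.
Qed.

Lemma recurrent_close (M : metricType R) (f : M -> M) (x : M) (e : R) :
  recurrent f x -> 0 < e ->
  exists n : nat, (0 < n)%N /\ mdist x (iter n f x) < e.
Proof.
move=> rx e0; have [|n [n0 /interior_subset]] := rx _ (@open_interior _ (ball x e)).
  exact: nbhsx_ballx.
by rewrite ballEmdist; exists n.
Qed.

End MetricSpaces.

(** * The metric on bisequences *)

Section BisequenceMetric.
Variable R : realType.
Implicit Types s t : bisequence R.

(** The distance is $e^{-m}$ with $m$ the least absolute value of an index of disagreement, so the
    strict inequality says $m>N$; the default distance 0 covers equal bisequences. *)
Lemma bidist_lt s t (N : nat) :
  mdist s t < expR (- N%:R) <-> forall k : int, (`|k| <= N)%N -> s k = t k.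
Proof.
rewrite [mdist s t]/(bidist s t) /bidist; split=> [+ k kN|st].
  case: pselect => [h|nh _]; last first.
    by apply: contrapT => nst; apply: nh; exists `|k|%N; apply/asboolP; exists k.
  case: ex_minnP => m _ minm; rewrite ltr_expR ltrN2 ltr_nat => Nm.
  apply: contrapT => nst; have : (m <= `|k|)%N.
    by apply: minm; apply/asboolP; exists k.
  by rewrite leqNgt (leq_ltn_trans kN Nm).
case: pselect => [h|_]; last exact: expR_gt0.
case: ex_minnP => m /asboolP[k [<- nst]] _.
by rewrite ltr_expR ltrN2 ltr_nat ltnNge; apply/negP => /st.
Qed.

Lemma exists_expRN_lt (e : R) : 0 < e -> exists N : nat, expR (- N%:R) < e.
Proof.
move=> e0; have l01 : 0 <= expR (- 1 : R) < 1 by rewrite expR_ge0 expR_lt1 ltrN10.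
have [N] := exprn_cvg0 1 l01 e0; rewrite mulr1 -expRM_natl mulrN1.
by exists N.
Qed.

End BisequenceMetric.

(** * Ultrametric arithmetic *)

Section ValuedField.
Variables (R : realType) (K : fieldType) (v : nonArchAbs R K).
Local Notation Kv := (valued v).
Implicit Types (x y z : Kv) (r : R).

Lemma mdist_absE x y : mdist x y = v (x - y).
Proof. by []. Qed.

Lemma absM x y : v (x * y) = v x * v y.
Proof. exact: absvalM. Qed.

Lemma absX x n : v (x ^+ n) = v x ^+ n.
Proof. by elim: n => [|n IH]; rewrite ?absval1// !exprS absM IH. Qed.

Lemma absN x : v (- x) = v x.
Proof. exact: absvalN. Qed.

Lemma abs_distC x y : v (x - y) = v (y - x).
Proof. by rewrite -absN opprB. Qed.

Lemma abs_eq0 x : (v x == 0) = (x == 0).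
Proof. by apply/eqP/eqP => [/absval_eq0//|->]; exact: absval0. Qed.

Lemma abs_gt0 x : (0 < v x) = (x != 0).
Proof. by rewrite lt_neqAle eq_sym abs_eq0 absval_ge0 andbT. Qed.

Lemma absV x : v (x^-1) = (v x)^-1.
Proof.
have [->|x0] := eqVneq x 0; first by rewrite invr0 absval0 invr0.
have vx0 : v x != 0 by rewrite abs_eq0.
by apply: (mulfI vx0); rewrite -absM !mulfV// absval1.
Qed.

Lemma absf_div x y : v (x / y) = v x / v y.
Proof. by rewrite absM absV. Qed.

Lemma absD_le x y r : v x <= r -> v y <= r -> v (x + y) <= r.
Proof. by move=> xr yr; apply: le_trans (absvalD _ _ _) _; rewrite ge_max xr. Qed.

Lemma absB_le x y r : v x <= r -> v y <= r -> v (x - y) <= r.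
Proof. by move=> xr yr; rewrite absD_le// absN. Qed.

Lemma absD_lt x y r : v x < r -> v y < r -> v (x + y) < r.
Proof.
by move=> xr yr; apply: le_lt_trans (absvalD _ _ _) _; rewrite gt_max xr.
Qed.

Lemma absB_lt x y r : v x < r -> v y < r -> v (x - y) < r.
Proof. by move=> xr yr; rewrite absD_lt// absN. Qed.

(** Otherwise $x=(x+y)-y$ would be a difference of two elements smaller than $x$. *)
Lemma absD_eql x y : v y < v x -> v (x + y) = v x.
Proof.
move=> yx; apply/eqP; rewrite eq_le absD_le ?(ltW yx)//= leNgt; apply/negP => h.
by have := absB_lt h yx; rewrite addrK ltxx.
Qed.

Lemma abs_close_eq x y : v (x - y) < v x -> v y = v x.
Proof. by move=> xy; rewrite -(subKr x y) absD_eql ?absN. Qed.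

Lemma absn_le1 n : v (n%:R : Kv) <= 1.
Proof.
by elim: n => [|n IH]; rewrite ?absval0// -addn1 natrD absD_le// absval1.
Qed.

(** The odd characteristic $p$ satisfies $|p|<1$. If also $|2|<1$, then $1=p-2\lfloor p/2\rfloor$
    would have absolute value below 1. *)
Lemma abs2_odd_residue :
  (exists2 p : nat, odd p & p \in [pchar (residue_field v)]) ->
  v (2 : Kv) = 1.
Proof.
case=> p podd /andP[_ /eqP p0].
have p1 : v (p%:R : Kv) < 1.
  have : (p%:R : valuation_ring v) - 0 \in maximal_ideal (v := v).
    rewrite Quotient.idealrBE; apply/eqP.
    by rewrite rmorph_nat p0 rmorph0.
  rewrite subr0 unfold_in /maximal_ideal.
  by rewrite -[vr_val _]/(val (p%:R : valuation_ring v)) rmorph_nat.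
apply/eqP; rewrite eq_le absn_le1/= leNgt; apply/negP => two1.
have half1 : v ((p./2.*2)%:R : Kv) < 1.
  rewrite -mul2n natrM absM; apply: le_lt_trans two1.
  by rewrite ler_piMr ?absval_ge0 ?absn_le1.
have := absB_lt p1 half1.
by rewrite -{1}(odd_double_half p) podd natrD addrK absval1 ltxx.
Qed.

(** * Newton iteration over a complete field *)

Section Complete.
Hypothesis K_complete : complete_space Kv.

(** The rate [c] passes to the limit without loss: if $|u_n-l|>c_n$, a late term $u_m$ is closer
    than $|u_n-l|$ to both $u_n$ and $l$, against the ultrametric inequality. *)
Lemma ultrametric_cauchy_limit (u : nat -> Kv) (c : nat -> R) :
  (forall e, 0 < e -> exists n, c n < e) ->
  (forall m n, (n <= m)%N -> v (u n - u m) <= c n) ->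
  exists l : Kv, forall n, v (u n - l) <= c n.
Proof.
move=> c0 uc.
have cu : cauchy (u @ \oo).
  apply: cauchy_exP => e e0; have [n cne] := c0 e e0; exists (u n).
  exists n => // m nm /=; rewrite ballEmdist/=.
  exact: (le_lt_trans (uc m n nm)).
have FF : ProperFilter (u @ \oo) by exact: fmap_proper_filter.
have ul := K_complete FF cu; set l := lim _ in ul.
exists l => n; rewrite leNgt; apply/negP => cn.
have c_ge0 : 0 < v (u n - l).
  by apply: le_lt_trans cn; apply: le_trans (uc n n _) => //; exact: absval_ge0.
have lU : nbhs l (ball l (v (u n - l))) by exact: nbhsx_ballx.
have [N _ NU] := ul _ lU.
have := NU _ (leq_maxl N n); rewrite /= ballEmdist/= => lu.
have un : v (u n - u (maxn N n)) < v (u n - l).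
  by apply: le_lt_trans cn; apply: uc; exact: leq_maxr.
by have := absB_lt un lu; rewrite opprB addrA subrK ltxx.
Qed.

(* The index set is the singleton when extracting square roots by Newton
   iteration, and the integers when solving for a whole bounded orbit. *)
Lemma uniform_fixed_point (I : Type) (F : (I -> Kv) -> I -> Kv) (x0 : I -> Kv)
    (rho lam : R) :
  0 <= lam < 1 -> 0 <= rho ->
  let D := [set f : I -> Kv | forall i, v (f i - x0 i) <= rho] in
  (forall f, D f -> D (F f)) ->
  (forall f g r, D f -> D g -> (forall i, v (f i - g i) <= r) ->
     forall i, v (F f i - F g i) <= lam * r) ->
  exists2 f, D f & F f = f.
Proof.
move=> lam01 rho0 D FD Flip; have /andP[lam0 lam1] := lam01.
pose u n := iter n F x0.
have D0 : D x0 by move=> i; rewrite subrr absval0.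
have Du n : D (u n) by elim: n => //= n; exact: FD.
have step n i : v (u n i - u n.+1 i) <= lam ^+ n * rho.
  elim: n i => [|n IH] i.
    by rewrite mul1r abs_distC; exact: (Du 1%N).
  by rewrite exprS -mulrA; exact: (Flip (u n) (u n.+1)).
have uc m n i : (n <= m)%N -> v (u n i - u m i) <= lam ^+ n * rho.
  move=> /subnKC <-; elim: (m - n)%N => [|k IH].
    by rewrite addn0 subrr absval0 mulr_ge0 ?exprn_ge0.
  rewrite addnS -(subrKA (u (n + k)%N i)) absD_le//; apply: le_trans (step _ _) _.
  by rewrite ler_wpM2r// ler_wiXn2l ?leq_addr// ltW.
have [x xlim] := choice (fun i => ultrametric_cauchy_limit
  (fun e e0 => exprn_cvg0 rho lam01 e0) (fun m n => uc m n i)).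
have Dx : D x.
  move=> i; have := xlim i 0%N; by rewrite mul1r abs_distC.
exists x => //; apply/funext => i; apply/eqP; rewrite -subr_eq0 -abs_eq0.
rewrite eq_le absval_ge0 andbT leNgt; apply/negP => Fx.
have [n] := exprn_cvg0 rho lam01 Fx; apply/negP; rewrite -leNgt.
rewrite -(subrKA (u n.+1 i)) absD_le//.
  rewrite abs_distC; apply: (@le_trans _ _ (lam ^+ n.+1 * rho)).
    by rewrite exprS -mulrA; apply: (Flip (u n) x) => // j; exact: xlim.
  by rewrite ler_wpM2r// ler_wiXn2l ?leqnSn// ltW.
apply: (le_trans (xlim i n.+1)).
by rewrite ler_wpM2r// ler_wiXn2l ?leqnSn// ltW.
Qed.

(** A form of Hensel's lemma. Newton's iteration with its slope frozen at $2x$ preserves the ball of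
    radius $|a-x^2|/|x|$ around $x$ and contracts it by $|a-x^2|/|x|^2<1$; $|2|=1$ keeps the slope
    of size $|x|$. *)
Lemma square_of_near_square (a x : Kv) :
  v (2 : Kv) = 1 -> v (a - x ^+ 2) < v x ^+ 2 -> exists c : Kv, a = c ^+ 2.
Proof.
move=> v2 ax; have x2 : 0 < v x ^+ 2 := le_lt_trans (absval_ge0 _ _) ax.
have x0 : x != 0 by apply: contraTneq x2 => ->; rewrite absval0 expr0n ltxx.
have x_gt0 : 0 < v x by rewrite abs_gt0.
have two0 : (2 : Kv) != 0 by rewrite -abs_gt0 v2.
pose rho := v (a - x ^+ 2) / v x.
pose F (z : unit -> Kv) i : Kv := z i - (z i ^+ 2 - a) / (2 * x).
have v2x : v (2 * x) = v x by rewrite absM v2 mul1r.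
have rho0 : 0 <= rho by rewrite divr_ge0 ?absval_ge0.
have rhox : rho <= v x by rewrite ler_pdivrMr// -expr2 ltW.
have rho2 : rho * v x = v (a - x ^+ 2) by rewrite divfK// gt_eqF.
have lam : 0 <= rho / v x < 1.
  by rewrite divr_ge0 ?absval_ge0//= ltr_pdivrMr// mul1r ltr_pdivrMr// -expr2.
have [|y z r Dy Dz yz i|z _ zF] :=
  @uniform_fixed_point unit F (fun=> x) _ _ lam rho0.
- move=> z Dz i.
  have -> : F z i - x = ((a - x ^+ 2) - (z i - x) ^+ 2) / (2 * x).
    by rewrite /F; field; rewrite x0.
  rewrite absf_div v2x ler_pdivrMr// rho2 absB_le// absX -rho2 expr2.
  rewrite ler_pM ?absval_ge0// ?Dz//; exact: le_trans rhox.
- have -> : F y i - F z i = (y i - z i) * ((x - z i) - (y i - x)) / (2 * x).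
    by rewrite /F; field; rewrite x0.
  rewrite absf_div v2x absM ler_pdivrMr//.
  rewrite mulrAC divfK ?gt_eqF// mulrC ler_pM ?absval_ge0 ?yz//.
  by apply: absB_le; [rewrite abs_distC; exact: Dz|exact: Dy].
exists (z tt); apply/esym/eqP; rewrite -subr_eq0.
have := congr1 (fun g => g tt) zF; rewrite /F => /eqP.
by rewrite -subr_eq0 addrAC subrr sub0r oppr_eq0 mulf_eq0 invr_eq0 mulf_eq0
  (negbTE two0) (negbTE x0) !orbF.
Qed.

End Complete.
End ValuedField.

(** * Invariance of [J] under the map and its inverse *)

Section Dynamics.
Variables (R : realType) (K : fieldType) (v : nonArchAbs R K).
Local Notation Kv := (valued v).
Variables (a b : Kv).
Hypothesis b_neq0 : b != 0.
Implicit Types (p q : Kv * Kv) (r : R).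
Local Notation H := (henon a b).
Local Notation G := (henon_inv a b).
Local Notation J := (julia a b).

Let b_gt0 : 0 < v b. Proof. by rewrite abs_gt0. Qed.
Let HK : cancel H G := henonK a b_neq0.
Let GK : cancel G H := henon_invK a b_neq0.

Lemma norm2_le p r : (norm2 p <= r) = (v p.1 <= r) && (v p.2 <= r).
Proof. by rewrite ge_max. Qed.

Lemma norm2_distC p q : norm2 (p - q) = norm2 (q - p).
Proof. by rewrite -!mdist_norm2 metric_sym. Qed.

Lemma cball0E r : cball v r (0, 0) = [set p | norm2 p <= r].
Proof.
by apply/seteqP; split=> p; rewrite /cball /closed_ball_ /= norm2_distC subr0.
Qed.

Lemma henon_iterN n p : henon_iter a b (- n%:Z) p = iter n G p.
Proof. by case: n. Qed.

Lemma julia_henon p : J p -> J (H p).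
Proof.
move=> [[M1 HM] [M2 GM]]; split.
  by exists M1 => n; have := HM n.+1; rewrite /henon_iter iterSr.
(* The backward orbit of [H p] is [H p] followed by the backward orbit of [p]. *)
exists (Num.max M2 (norm2 (H p))) => -[|n].
  by rewrite oppr0 le_max lexx orbT.
by rewrite henon_iterN iterSr HK le_max -henon_iterN GM.
Qed.

Lemma julia_henon_inv p : J p -> J (G p).
Proof.
move=> [[M1 HM] [M2 GM]]; split; last first.
  by exists M2 => n; have := GM n.+1; rewrite !henon_iterN iterSr.
exists (Num.max M1 (norm2 (G p))) => -[|n].
  by rewrite le_max lexx orbT.
by rewrite /henon_iter iterSr GK le_max HM.
Qed.

Lemma julia_iter p n : J p -> J (iter n H p) /\ J (iter n G p).
Proof.
by move=> Jp; elim: n => // n [h1 h2]; split;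
  [exact: julia_henon|exact: julia_henon_inv].
Qed.

(** * Escape estimates and the bounding radius of [J] *)

Section Escape.
Variable r : R.
Hypotheses (r1 : 1 <= r) (br : v b <= r) (ar : v a <= r ^+ 2).

Let r0 : 0 < r := lt_le_trans ltr01 r1.

(** Here $x^2$ strictly dominates $a$ and $by$, so $|x|$ is squared at each step and the first
    coordinate stays the larger one; only a factor $|p_1|$ per step is retained. *)
Lemma henon_escape p n : r < v p.1 -> v p.2 <= v p.1 ->
  v p.1 ^+ n * v p.1 <= v (iter n H p).1 /\ v (iter n H p).2 <= v (iter n H p).1.
Proof.
move=> rp p21; have p1 : 1 <= v p.1 by rewrite (le_trans r1)// ltW.
elim: n => [|n [IH1 IH2]]; first by rewrite mul1r.
rewrite iterS; move: (iter n H p) IH1 IH2 => [x y] /= IH1 IH2.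
have px : v p.1 <= v x.
  by apply: le_trans IH1; rewrite ler_peMl ?absval_ge0// exprn_ege1.
have rx : r < v x := lt_le_trans rp px.
have x0 : 0 < v x := lt_trans r0 rx.
have -> : v (a + b * y - x ^+ 2) = v x ^+ 2.
  rewrite abs_distC absD_eql ?absN absX// absD_lt//.
    by apply: (le_lt_trans ar); rewrite ltrXn2r// ltW.
  rewrite absM; apply: (@le_lt_trans _ _ (r * v x)).
    by rewrite ler_pM ?absval_ge0.
  by rewrite expr2 ltr_pM2r.
split.
  rewrite exprS -mulrA expr2.
  by rewrite ler_pM ?absval_ge0// mulr_ge0 ?exprn_ge0 ?absval_ge0.
by rewrite expr2 ler_peMl ?absval_ge0// (le_trans r1) ?ltW.
Qed.

(** Now $y^2$ dominates $a$ and $x$, so $|y|$ becomes $|y|^2/|b|$; the factor $|p_2|/|b|$ exceeds 1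
    because $|b|\le r$. *)
Lemma henon_inv_escape p n : r < v p.2 -> v p.1 <= v p.2 ->
  (v p.2 / v b) ^+ n * v p.2 <= v (iter n G p).2 /\
  v (iter n G p).1 <= v (iter n G p).2.
Proof.
move=> rp p12; have bp : v b < v p.2 := le_lt_trans br rp.
have t1 : 1 <= v p.2 / v b by rewrite ler_pdivlMr// mul1r ltW.
have t0 : 0 <= v p.2 / v b := le_trans ler01 t1.
elim: n => [|n [IH1 IH2]]; first by rewrite mul1r.
rewrite iterS; move: (iter n G p) IH1 IH2 => [x y] /= IH1 IH2.
have py : v p.2 <= v y.
  by apply: le_trans IH1; rewrite ler_peMl ?absval_ge0// exprn_ege1.
have ry : r < v y := lt_le_trans rp py.
have y0 : 0 < v y := lt_trans r0 ry.
have y1 : 1 < v y := le_lt_trans r1 ry.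
have -> : v (b^-1 * (- a + x + y ^+ 2)) = v y ^+ 2 / v b.
  rewrite mulrC absf_div addrC absD_eql absX// absD_lt// ?absN.
    by apply: (le_lt_trans ar); rewrite ltrXn2r// ltW.
  by apply: (le_lt_trans IH2); rewrite expr2 ltr_pMr.
split; last by rewrite ler_pdivlMr// expr2 ler_pM2l// (le_trans br)// ltW.
rewrite exprS -mulrA expr2 [leRHS]mulrAC.
rewrite ler_pM ?mulr_ge0 ?exprn_ge0 ?invr_ge0 ?absval_ge0//.
by rewrite ler_pM2r ?invr_gt0.
Qed.

(** The larger coordinate decides the direction of time in which a point outside the ball
    escapes. *)
Lemma julia_norm_le p : J p -> norm2 p <= r.
Proof.
move=> [[M1 HM] [M2 GM]]; rewrite leNgt; apply/negP.
rewrite lt_max.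
have [p21|/ltW p12] := leP (v p.2) (v p.1).
  move=> rp; have {}rp : r < v p.1 by case/orP: rp => // /lt_le_trans; exact.
  have [||n] := @geometric_unbounded R (v p.1) (v p.1) M1.
  - exact: le_lt_trans rp.
  - exact: lt_trans rp.
  have [+ _] := henon_escape n rp p21 => /[swap] /lt_le_trans /[apply].
  by apply/negP; rewrite -leNgt; have := HM n; rewrite norm2_le => /andP[].
move=> rp; have {}rp : r < v p.2 by case/orP: rp => // /lt_le_trans; exact.
have [||n] := @geometric_unbounded R (v p.2 / v b) (v p.2) M2.
- by rewrite ltr_pdivlMr// mul1r (le_lt_trans br).
- exact: lt_trans rp.
have [+ _] := henon_inv_escape n rp p12 => /[swap] /lt_le_trans /[apply].
apply/negP; rewrite -leNgt; have := GM n.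
by rewrite henon_iterN norm2_le => /andP[].
Qed.

Lemma juliaP p :
  J p <-> forall n, norm2 (iter n H p) <= r /\ norm2 (iter n G p) <= r.
Proof.
split=> [Jp n|Jp].
  by have [h1 h2] := julia_iter n Jp; split; exact: julia_norm_le.
by split; exists r => n; have [h1 h2] := Jp n; rewrite ?henon_iterN.
Qed.

End Escape.

(** * Continuity of the maps and topology of balls *)

Lemma continuous_henon : continuous H.
Proof.
apply: (@locally_lipschitz_continuous R) => p.
exists (Num.max 1 (Num.max (v b) (v p.1))) => q.
rewrite !mdist_norm2 => pq; rewrite {1}/norm2 ge_max /=.
apply/andP; split; last first.
  apply: (@le_trans _ _ (1 * norm2 (p - q))).
    by rewrite mul1r le_max lexx.
  by rewrite ler_wpM2r ?le_max ?lexx// absval_ge0.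
have N0 : 0 <= norm2 (p - q) by rewrite le_max absval_ge0.
(* The factor $p_1+q_1$ is written as $2p_1-(p_1-q_1)$ with $|p_1-q_1|\le1$, so that the constant
   depends on [p] alone. *)
have -> : a + b * p.2 - p.1 ^+ 2 - (a + b * q.2 - q.1 ^+ 2) =
    b * (p.2 - q.2) - (p.1 + p.1 - (p.1 - q.1)) * (p.1 - q.1) by ring.
have d1 : v (p.1 - q.1) <= norm2 (p - q) by rewrite le_max lexx.
have d2 : v (p.2 - q.2) <= norm2 (p - q) by rewrite le_max lexx orbT.
apply: absB_le; rewrite absM ler_pM ?absval_ge0//.
  by rewrite !le_max lexx orbT.
apply: absB_le; last by rewrite le_max (le_trans d1).
by apply: absD_le; rewrite !le_max lexx !orbT.
Qed.

Lemma continuous_henon_inv : continuous G.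
Proof.
apply: (@locally_lipschitz_continuous R) => p.
exists (Num.max 1 (v (b^-1) * Num.max 1 (v p.2))) => q.
rewrite !mdist_norm2 => pq; rewrite {1}/norm2 ge_max /=.
have N0 : 0 <= norm2 (p - q) by rewrite le_max absval_ge0.
have d1 : v (p.1 - q.1) <= norm2 (p - q) by rewrite le_max lexx.
have d2 : v (p.2 - q.2) <= norm2 (p - q) by rewrite le_max lexx orbT.
apply/andP; split.
  by apply: (le_trans d2); rewrite ler_peMl// le_max lexx.
have -> : b^-1 * (- a + p.1 + p.2 ^+ 2) - b^-1 * (- a + q.1 + q.2 ^+ 2) =
    b^-1 * (1 * (p.1 - q.1) + (p.2 + p.2 - (p.2 - q.2)) * (p.2 - q.2)) by ring.
apply: (@le_trans _ _ (v (b^-1) * Num.max 1 (v p.2) * norm2 (p - q))).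
  rewrite absM -mulrA ler_wpM2l ?absval_ge0//.
  apply: absD_le; rewrite absM ler_pM ?absval_ge0//.
    by rewrite absval1 le_max lexx.
  apply: absB_le; last by rewrite le_max (le_trans d2).
  by apply: absD_le; rewrite !le_max lexx !orbT.
by rewrite ler_wpM2r// le_max lexx orbT.
Qed.

Lemma norm2D_lt p q r : norm2 p < r -> norm2 q < r -> norm2 (p + q) < r.
Proof.
by rewrite !gt_max => /andP[p1 p2] /andP[q1 q2]; rewrite !absD_lt.
Qed.

Lemma closed_norm2_le r : 0 < r -> closed [set p : Kv * Kv | norm2 p <= r].
Proof.
move=> r0; rewrite -openC openE => p /= /negP; rewrite -ltNge => rp.
apply/(nbhs_mdistP p); exists (norm2 p); first exact: lt_trans rp.
move=> q; rewrite mdist_norm2 => pq /= qr.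
by have := norm2D_lt pq (le_lt_trans qr rp); rewrite subrK ltxx.
Qed.

(** An ultrametric ball of radius [r] contains the ball of radius [r] around each of its points. *)
Lemma open_norm2_le r : 0 < r -> open [set p : Kv * Kv | norm2 p <= r].
Proof.
move=> r0; rewrite openE => p /= pr; apply/(nbhs_mdistP p); exists r => // q.
rewrite mdist_norm2 gt_max /= => /andP[/ltW pq1 /ltW pq2].
move: pr; rewrite !norm2_le => /andP[p1 p2].
by rewrite -(subKr p.1 q.1) -(subKr p.2 q.2); apply/andP; split; exact: absB_le.
Qed.

(** * Compactness of [J], nonemptiness for large $b$, and the unit-ball criterion *)

Hypotheses (v_nontrivial : exists x : K, x != 0 /\ v x != 1)
  (K_locally_compact : locally_compact [set: Kv]).

Lemma exists_abs_gt r : exists x : Kv, r < v x.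
Proof.
have [x x1] : exists x : Kv, 1 < v x.
  have [x [x0]] := v_nontrivial; rewrite neq_lt => /orP[x1|]; last by exists x.
  by exists (x^-1 : Kv); rewrite absV invf_gt1// (@abs_gt0 _ _ v x).
have [n] := geometric_unbounded r x1 ltr01; rewrite mulr1 -absX.
by exists (x ^+ n).
Qed.

(** Multiplication by an element of absolute value above [r / e] stretches a compact neighbourhood
    of 0, containing the [e]-ball, into a compact set that covers this closed one. *)
Lemma compact_abs_le r : 0 < r -> compact [set x : Kv | v x <= r].
Proof.
move=> r0; have := K_locally_compact (I : [set: Kv] 0).
move=> [U /nbhs_mdistP[e e0 eU] [cU _]].
have [t rt] := exists_abs_gt (r / e).
have t_gt0 : 0 < v t by apply: lt_trans rt; rewrite divr_gt0.
have t0 : t != 0 by rewrite -abs_gt0.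
have ct : continuous ( *%R t : Kv -> Kv).
  apply: (@locally_lipschitz_continuous R) => x; exists (v t) => y _.
  by rewrite !mdist_absE -mulrBr absM.
apply: (@subclosed_compact _ _ ( *%R t @` U)); last 2 first.
- by apply: continuous_compact => //; exact: continuous_subspaceT.
- move=> x /= xr; exists (t^-1 * x); last by rewrite mulVKf.
  apply: (eU _ _ I); rewrite mdist_absE sub0r absN absM absV mulrC.
  by rewrite ltr_pdivrMr// (le_lt_trans xr)// mulrC -ltr_pdivrMr.
rewrite -openC openE => x /= /negP; rewrite -ltNge => rx.
apply/(nbhs_mdistP x); exists (v x); first exact: lt_trans rx.
by move=> y xy; apply/negP; rewrite -ltNge (abs_close_eq xy).
Qed.

Lemma compact_norm2_le r : 0 < r -> compact [set p : Kv * Kv | norm2 p <= r].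
Proof.
move=> r0; have cr := compact_abs_le r0.
rewrite (_ : [set _ | _] = [set x : Kv | v x <= r] `*` [set x : Kv | v x <= r]).
  exact: compact_setX.
by apply/seteqP; split=> p /=; rewrite norm2_le => /andP.
Qed.

Lemma compact_julia : compact J.
Proof.
(* The smallest radius to which the escape estimates apply. *)
pose r := Num.max 1 (Num.max (v b) (Num.sqrt (v a))).
have r1 : 1 <= r by rewrite le_max lexx.
have br : v b <= r by rewrite !le_max lexx orbT.
have ar : v a <= r ^+ 2.
  rewrite -[leLHS]sqr_sqrtr ?absval_ge0// lerXn2r ?nnegrE ?sqrtr_ge0//.
    exact: le_trans ler01 r1.
  by rewrite !le_max lexx !orbT.
have r0 := lt_le_trans ltr01 r1.
apply: (subclosed_compact _ (compact_norm2_le r0)); last first.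
  by move=> p /(julia_norm_le r1 br ar).
rewrite (_ : J = \bigcap_n ((iter n H) @^-1` [set p | norm2 p <= r] `&`
                           (iter n G) @^-1` [set p | norm2 p <= r])).
  have clB : closed [set p : Kv * Kv | norm2 p <= r] := closed_norm2_le r0.
  apply: closed_bigI => n _; apply: closedI.
    by have /continuous_closedP := @continuous_iter _ H n continuous_henon; apply.
  by have /continuous_closedP := @continuous_iter _ G n continuous_henon_inv; apply.
apply/seteqP; split=> p; first by move=> /(juliaP r1 br ar) Jp n _; exact: Jp.
by move=> Jp; apply/(juliaP r1 br ar) => n; exact: Jp.
Qed.

(** The inverse map sends the ball of radius $|b|$ into itself, since $|-a+x+y^2|\le|b|^2$ there. A
    limit point of the backward orbit of 0 therefore has its forward orbit in the ball as well. *)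
Lemma julia_neq0_of_large_b : 1 <= v b -> v a <= v b ^+ 2 -> J !=set0.
Proof.
move=> b1 ab; pose B := [set p : Kv * Kv | norm2 p <= v b].
have GB p : B p -> B (G p).
  rewrite /B /= !norm2_le => /andP[p1 p2] /=; rewrite p2 /= mulrC absf_div.
  rewrite ler_pdivrMr// -expr2 !absD_le ?absN ?absX//.
    by rewrite (le_trans p1)// expr2 ler_peMl ?absval_ge0.
  by rewrite lerXn2r ?nnegrE ?absval_ge0.
have B0 : B 0 by rewrite /B /= norm2_le /= absval0 ltW.
have [z [HB _]] := omega_limit GK continuous_henon (compact_norm2_le b_gt0)
  (closed_norm2_le b_gt0) GB B0 (@leqnn).
have Bz : B z := HB 0%N.
exists z; apply/(juliaP b1 (lexx _) ab) => n; split; first exact: HB.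
by elim: n => // n; exact: GB.
Qed.

Lemma region_I_julia_ball : region_I v (a, b) <-> J = cball v 1 (0, 0).
Proof.
rewrite cball0E; split=> [[_ /= [a1 b1]]|JE].
  apply/seteqP; split=> p; first by apply: julia_norm_le; rewrite ?b1 ?expr1n.
  move=> p1; apply/(@juliaP 1); rewrite ?b1 ?expr1n// => n.
  split; elim: n => //= n; move: (iter n _ p) => q;
    rewrite !norm2_le /= => /andP[q1 q2].
    rewrite q1 andbT !absD_le ?absM ?absN ?absX ?b1 ?mul1r//.
    by rewrite exprn_ile1 ?absval_ge0.
  rewrite q2 absM absV b1 invr1 mul1r.
  by rewrite !absD_le ?absN ?absX ?exprn_ile1 ?absval_ge0.
have JB p : (v p.1 <= 1) && (v p.2 <= 1) <-> J p by rewrite JE /= norm2_le.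
(* Three test points suffice: images of $(0,0)$ and $(0,1)$ bound $a$ and $a+b$, hence $b$;
   preimages of $(0,0)$ and $(1,0)$ bound $-a/b$ and $(1-a)/b$, hence $1/b$. *)
have J00 : J (0, 0) by apply/JB; rewrite /= absval0 ler01.
have J01 : J (0, 1) by apply/JB; rewrite /= absval0 absval1 ler01 lexx.
have J10 : J (1, 0) by apply/JB; rewrite /= absval0 absval1 ler01 lexx.
have /JB/= := julia_henon J00; rewrite mulr0 addr0 expr0n subr0 => /andP[a1 _].
have /JB/= := julia_henon J01; rewrite mulr1 expr0n subr0 => /andP[ab1 _].
have b1 : v b <= 1 by rewrite -(addKr a b) absD_le ?absN.
have /JB/= := julia_henon_inv J00; rewrite expr0n !addr0 => /andP[_ ba1].
have /JB/= := julia_henon_inv J10; rewrite expr0n addr0 => /andP[_ ba2].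
split=> //; split=> //; apply/eqP; rewrite eq_le b1 /=.
have := absB_le ba2 ba1; rewrite -mulrBr addrAC subrr add0r mulr1 absV.
by rewrite invf_le1.
Qed.

(** * Recurrence and attraction when $|a|,|b|\le1$ *)

Section UnitBall.
Hypotheses (a1 : v a <= 1) (b1 : v b <= 1).

Let a1' : v a <= 1 ^+ 2. Proof. by rewrite expr1n. Qed.
Let B := [set p : Kv * Kv | norm2 p <= 1].

Lemma henon_unit_ball p : norm2 p <= 1 -> norm2 (H p) <= 1.
Proof.
rewrite !norm2_le /= => /andP[p1 p2].
rewrite p1 andbT !absD_le ?absM ?absN ?absX//.
  by rewrite mulr_ile1 ?absval_ge0.
by rewrite exprn_ile1 ?absval_ge0.
Qed.

Lemma henon_iter_unit_ball p n : norm2 p <= 1 -> norm2 (iter n H p) <= 1.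
Proof. by move=> p1; elim: n => //= n; exact: henon_unit_ball. Qed.

Lemma henon_nonexpanding p q n : norm2 p <= 1 -> norm2 q <= 1 ->
  mdist (iter n H p) (iter n H q) <= mdist p q.
Proof.
move=> p1 q1; elim: n => // n; apply: le_trans; rewrite !iterS.
move: (henon_iter_unit_ball n p1) (henon_iter_unit_ball n q1).
move: (iter n H p) (iter n H q) => {p1 q1}p {}q.
rewrite !mdist_norm2 !norm2_le => /andP[p1 _] /andP[q1 _].
have d1 : v (p.1 - q.1) <= norm2 (p - q) by rewrite le_max lexx.
have d2 : v (p.2 - q.2) <= norm2 (p - q) by rewrite le_max lexx orbT.
rewrite /= d1 andbT.
have -> : a + b * p.2 - p.1 ^+ 2 - (a + b * q.2 - q.1 ^+ 2) =
    b * (p.2 - q.2) - (p.1 + q.1) * (p.1 - q.1) by ring.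
apply: absB_le; rewrite absM.
  by apply: le_trans d2; rewrite ler_piMl ?absval_ge0.
by apply: le_trans d1; rewrite ler_piMl ?absval_ge0// absD_le.
Qed.

(** The times [h] are left free: the identity yields nonemptiness of [J], and a choice of bad times
    yields convergence to [J]. *)
Lemma julia_limit p (h : nat -> nat) :
  norm2 p <= 1 -> (forall n, (n <= h n)%N) ->
  exists2 z, J z & forall U, nbhs z U -> exists n, U (iter (h n) H p).
Proof.
move=> p1 hn; have [z [GB clz]] := omega_limit HK continuous_henon_inv
  (compact_norm2_le ltr01) (closed_norm2_le ltr01) henon_unit_ball p1 hn.
exists z => //; apply/(juliaP (lexx 1) b1 a1') => n; split; last exact: GB.
exact: henon_iter_unit_ball (GB 0%N).
Qed.

Lemma julia_neq0_of_unit : J !=set0.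
Proof.
have [||z Jz _] := @julia_limit 0 id; last by exists z.
- by rewrite norm2_le /= absval0 ler01.
- by move=> n; exact: leqnn.
Qed.

Lemma julia_recurrent p : J p -> recurrent H p.
Proof.
move=> Jp U oU Up; have /nbhs_mdistP[e e0 eU] : nbhs p U by exact: open_nbhs_nbhs.
have [m [n [mn Gmn]]] := compact_seq_close compact_julia
  (fun n => proj2 (julia_iter n Jp)) e0.
exists (n - m)%N; split; first by rewrite subn_gt0.
apply: eU; apply: le_lt_trans Gmn.
have GB k : norm2 (iter k G p) <= 1.
  by have /(juliaP (lexx 1) b1 a1')/(_ k)[] := Jp.
(* The [n]-th forward iterate sends [iter m G p] to [iter (n - m) H p] and [iter n G p] back to
   [p]. *)
apply: le_trans (henon_nonexpanding n (GB m) (GB n)).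
rewrite [iter n H (iter n G p)](iter_cancel n GK) -{2}(subnK (ltnW mn)) iterD.
by rewrite (iter_cancel m GK) metric_sym.
Qed.

(** A return closer than $\|p\|$ keeps the absolute value of the dominant coordinate. The escape
    estimates forbid this: forward from [p] if the first coordinate dominates, otherwise backward
    from the returned point [q]. *)
Lemma recurrent_unit_ball p : recurrent H p -> norm2 p <= 1.
Proof.
move=> rp; rewrite leNgt; apply/negP => p1.
have [n [n0]] := recurrent_close rp (lt_trans ltr01 p1).
rewrite mdist_norm2; set q := iter n H p => /[dup] pq.
rewrite gt_max /= => /andP[pq1 pq2].
have expr_gt1 (t : R) : 1 < t -> 1 < t ^+ n by move=> t1; rewrite exprn_egt1// -lt0n.
have [p21|p12] := leP (v p.2) (v p.1).
  have np : norm2 p = v p.1 by exact/max_idPl.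
  rewrite np in p1 pq1; have q1 := abs_close_eq pq1.
  have [+ _] := henon_escape (lexx 1) b1 a1' n p1 p21.
  by rewrite -/q q1 leNgt ltr_pMl ?expr_gt1// (lt_trans ltr01).
have np : norm2 p = v p.2 by exact/max_idPr/ltW.
rewrite np in p1 pq1 pq2; have q2 := abs_close_eq pq2.
have q12 : v q.1 <= v q.2 by rewrite q2 ltW// -(subKr p.1 q.1) absB_lt.
rewrite -q2 in p1; have [+ _] := henon_inv_escape (lexx 1) b1 a1' n p1 q12.
rewrite (iter_cancel n HK) -q2 leNgt ltr_pMl ?expr_gt1// ?(lt_trans ltr01)//.
by rewrite ltr_pdivlMr// mul1r (le_lt_trans b1).
Qed.

(** Induction on backward time. If [iter n.+1 G p] left the ball, the same would hold with [p]
    replaced by some return [iter m H p], $m\ge1$; but that gives [iter m.-1 H (iter n G p)], in the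
    ball by forward invariance. *)
Lemma recurrent_julia p : recurrent H p -> J p.
Proof.
move=> rp; have p1 := recurrent_unit_ball rp.
apply/(juliaP (lexx 1) b1 a1') => n; split; first exact: henon_iter_unit_ball.
elim: n => // n IH; apply: contrapT => GnB.
have cG := @continuous_iter _ G n.+1 continuous_henon_inv.
have [||m [m0]] := rp ((iter n.+1 G) @^-1` ~` B).
- by apply: open_comp; [move=> ? _; exact: cG|apply/closed_openC/closed_norm2_le].
- exact: GnB.
apply; rewrite /preimage /=.
have -> : G (iter n G (iter m H p)) = iter m.-1 H (iter n G p).
  rewrite -iterS -{1}(prednK m0) iterSr iterS HK.
  have -> : iter m.-1 H p = iter n H (iter m.-1 H (iter n G p)).
    by rewrite -iterD addnC iterD (iter_cancel n GK).
  exact: iter_cancel n HK _.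
exact: henon_iter_unit_ball.
Qed.

(** Otherwise the orbit is at distance at least [e] from [J] at arbitrarily late times, and its
    limit point along these times lies in [J]. *)
Lemma julia_dist_cvg0 p : norm2 p <= 1 ->
  dist_to J (iter n H p) @[n --> \oo] --> (0 : R).
Proof.
move=> p1; apply/cvgrPdist_lt => e e0; apply: contrapT => nlim.
have bad N : exists n, (N <= n)%N /\ e <= dist_to J (iter n H p).
  apply: contrapT => /forallNP nN; apply: nlim; exists N => // n /= Nn.
  have /not_andP[//|/negP] := nN n; rewrite -ltNge => dn.
  rewrite sub0r normrN ger0_norm//; apply: lb_le_inf.
    by have [z Jz] := julia_neq0_of_unit; exists (mdist (iter n H p) z), z.
  by move=> _ [z _ <-]; exact: mdist_ge0.
have [h hP] := choice bad.
have [z Jz clz] := julia_limit p1 (fun N => proj1 (hP N)).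
have [n zn] := clz _ (nbhsx_ballx z e e0).
have := proj2 (hP n); apply/negP; rewrite -ltNge.
apply: (@le_lt_trans _ _ (mdist (iter (h n) H p) z)).
  apply: ge_inf; last by exists z.
  by exists 0 => _ [y _ <-]; exact: mdist_ge0.
by move: zn; rewrite ballEmdist /= metric_sym.
Qed.

Lemma julia_attractor : v b < 1 -> attractor H J.
Proof.
move=> b_lt1; split; [exact: julia_neq0_of_unit|exact: compact_julia| |].
  apply/seteqP; split=> [_ [p Jp <-]|p Jp]; first exact: julia_henon.
  by exists (G p); [exact: julia_henon_inv|exact: GK].
exists B; split.
- exact: open_norm2_le.
- split; first by move=> p; exact: julia_norm_le.
  (* The inclusion is proper because equality with the unit ball would force $|b|=1$. *)
  move=> BJ; have /region_I_julia_ball[_ /= [_ b_eq1]] : J = cball v 1 (0, 0).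
    by rewrite cball0E; apply/seteqP; split => // p; exact: julia_norm_le.
  by move: b_lt1; rewrite b_eq1 ltxx.
- exact: julia_dist_cvg0.
Qed.

End UnitBall.

(** * Two-sided orbits as solutions of a second-order recurrence *)

Lemma henon_iterD1 k p : henon_iter a b (k + 1) p = H (henon_iter a b k p).
Proof.
case: k => [n|[|n]]; first by rewrite -PoszD addn1.
  by rewrite NegzE addNr /= GK.
by rewrite (_ : Negz n.+1 + 1 = Negz n) /= ?GK; last by lia.
Qed.

Lemma henon_iter_shift k p : henon_iter a b k (H p) = henon_iter a b (k + 1) p.
Proof.
case: k => [n|[|n]]; first by rewrite -PoszD addn1 /henon_iter iterSr.
  by rewrite NegzE addNr /= HK.
have -> : Negz n.+1 + 1 = Negz n by lia.
by rewrite /henon_iter [LHS]iterSr HK.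
Qed.

Lemma henon_iter_snd k p : (henon_iter a b k p).2 = (henon_iter a b (k - 1) p).1.
Proof. by rewrite -{1}(subrK 1 k) henon_iterD1. Qed.

Lemma henon_iter_recurrence k p :
  (henon_iter a b (k + 1) p).1 =
  a + b * (henon_iter a b (k - 1) p).1 - (henon_iter a b k p).1 ^+ 2.
Proof. by rewrite henon_iterD1 /= henon_iter_snd. Qed.

Lemma henon_iter_orbit (x : int -> Kv) :
  (forall k, x (k + 1) = a + b * x (k - 1) - x k ^+ 2) ->
  forall k, henon_iter a b k (x 0, x (- 1)) = (x k, x (k - 1)).
Proof.
move=> xE; have fwd n : iter n H (x 0, x (- 1)) = (x n%:Z, x (n%:Z - 1)).
  elim: n => [|n IH]; first by rewrite sub0r.
  by rewrite iterS IH /henon /= -xE -addn1 PoszD addrK.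
have bwd n : iter n G (x 0, x (- 1)) = (x (- n%:Z), x (- n%:Z - 1)).
  elim: n => [|n IH]; first by rewrite oppr0 sub0r.
  rewrite iterS IH /henon_inv /= -[n.+1]addn1 PoszD opprD; congr pair.
  have := xE (- n%:Z - 1); rewrite subrK => ->.
  by field.
by case=> n; [exact: fwd|rewrite NegzE; exact: bwd].
Qed.

Lemma continuous_henon_iter k : continuous (henon_iter a b k).
Proof.
case: k => n; apply: continuous_iter; first exact: continuous_henon.
exact: continuous_henon_inv.
Qed.

Lemma julia_abs_le r p k : 1 <= r -> v b <= r -> v a <= r ^+ 2 ->
  J p -> v (henon_iter a b k p).1 <= r.
Proof.
move=> r1 br ar /(juliaP r1 br ar) Jp.
by case: k => n; [have [+ _] := Jp n|have [_ +] := Jp n.+1];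
  rewrite norm2_le => /andP[].
Qed.

(** * Region III: a square root of $a$ from a point of [J] *)

Hypothesis v2 : v (2 : Kv) = 1.
Hypothesis K_complete : complete_space Kv.

(** With $r=\sqrt{|a|}$ all $|x_k|\le r$, and $r>1$, $r>|b|$ give $|a-x_0^2|=|x_1-bx_{-1}|<r^2=|a|$;
    so $x_0$ is an approximate root. *)
Lemma region_III_julia_square p :
  region_III v (a, b) -> J p -> exists c : Kv, a = c ^+ 2.
Proof.
rewrite /region_III /= gt_max => -[_ /andP[a1 ba]] Jp.
pose r := Num.sqrt (v a).
have r0 : 0 <= r := sqrtr_ge0 _.
have rE : r ^+ 2 = v a by rewrite sqr_sqrtr ?absval_ge0.
have r1 : 1 < r by rewrite -(@ltr_pXn2r _ 2) ?nnegrE// expr1n rE.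
have br : v b < r by rewrite -(@ltr_pXn2r _ 2) ?nnegrE ?absval_ge0// rE.
have ar : v a <= r ^+ 2 by rewrite rE.
have Jr k := julia_abs_le k (ltW r1) (ltW br) ar Jp.
have ax : v (a - (henon_iter a b 0 p).1 ^+ 2) < v a.
  rewrite -[X in v X](addrK (b * (henon_iter a b (0 - 1) p).1)).
  rewrite [X in v (X - _)]addrAC.
  rewrite -henon_iter_recurrence -rE absB_lt//.
    by apply: (le_lt_trans (Jr _)); rewrite expr2 ltr_pMl// (lt_trans ltr01).
  rewrite absM expr2; apply: (@le_lt_trans _ _ (v b * r)).
    by rewrite ler_wpM2l ?absval_ge0.
  by rewrite ltr_pM2r// (lt_trans ltr01).
apply: (square_of_near_square K_complete v2 (x := (henon_iter a b 0 p).1)).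
by rewrite -absX (abs_close_eq ax).
Qed.

(** * Symbolic coding of [J] in region III *)

Section Coding.
Variable c : Kv.
Hypotheses (ac : a = c ^+ 2) (c1 : 1 < v c) (bc : v b < v c).
Local Notation x_ k p := (henon_iter a b k p).1.

Let ar : v a <= v c ^+ 2. Proof. by rewrite ac absX. Qed.
Let c_gt0 : 0 < v c := lt_trans ltr01 c1.
Let two_neq0 : (2 : Kv) != 0. Proof. by rewrite -abs_gt0 v2. Qed.
(** [rho] bounds the coefficients $b$ and $1$ of the neighbouring terms and is the radius around the
    roots used in the Newton iteration. Division by a slope of size $|c|$ makes [lam] the
    contraction factor. *)
Let rho := Num.max 1 (v b).
Let lam := rho / v c.

Let rho1 : 1 <= rho. Proof. by rewrite le_max lexx. Qed.
Let rho_ge0 : 0 <= rho := le_trans ler01 rho1.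
Let rho_b : v b <= rho. Proof. by rewrite le_max lexx orbT. Qed.
Let rho_c : rho < v c. Proof. by rewrite gt_max c1. Qed.
Let lam01 : 0 <= lam < 1.
Proof. by rewrite divr_ge0 ?(ltW c_gt0)//= ltr_pdivrMr// mul1r. Qed.
Let lamc : lam * v c = rho. Proof. by rewrite divfK// gt_eqF. Qed.

Definition signed_root (s : bool) : Kv := if s then c else - c.

(** The itinerary of [p]. As $|2|=1$, the open balls of radius $|c|$ around $c$ and $-c$ are
    disjoint, and on [J] each $x_k$ lies in one of them, so testing the first is enough. *)
Definition code p : bisequence R := fun k => v (x_ k p - c) < v c.

Lemma signed_root_sqr s : signed_root s ^+ 2 = a.
Proof. by case: s; rewrite ac ?sqrrN. Qed.

Lemma abs_signed_root s : v (signed_root s) = v c.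
Proof. by case: s; rewrite ?absN. Qed.

Lemma signed_root_neq0 s : signed_root s != 0.
Proof. by rewrite -abs_gt0 abs_signed_root. Qed.

Lemma abs_sum_near_root (x y : Kv) s :
  v (x - signed_root s) < v c -> v (y - signed_root s) < v c ->
  v (x + y) = v c.
Proof.
move=> xs ys; have -> : x + y =
  2 * signed_root s + ((x - signed_root s) + (y - signed_root s)) by ring.
by rewrite absD_eql ?absM ?v2 ?abs_signed_root ?mul1r// absD_lt.
Qed.

(** The product $(x_k-c)(x_k+c)=bx_{k-1}-x_{k+1}$ is smaller than $|c|^2$, so the two factors cannot
    both reach $|c|$. *)
Lemma code_near_root p k : J p -> v (x_ k p - signed_root (code p k)) < v c.
Proof.
move=> Jp; rewrite /signed_root /code; case: ifP => //= /negbT.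
rewrite -leNgt => xc.
have Jc j := julia_abs_le j (ltW c1) (ltW bc) ar Jp.
have : v (x_ k p - c) * v (x_ k p + c) < v c * v c.
  rewrite -absM -subr_sqr -ac abs_distC.
  have -> : a - x_ k p ^+ 2 = x_ (k + 1) p - b * x_ (k - 1) p.
    by rewrite henon_iter_recurrence; ring.
  rewrite absB_lt//; first by apply: le_lt_trans (Jc _) _; rewrite ltr_pMl.
  rewrite absM; apply: (@le_lt_trans _ _ (v b * v c)).
    by rewrite ler_wpM2l ?absval_ge0.
  by rewrite ltr_pM2r.
rewrite opprK; apply: contraTT; rewrite -!leNgt => xc'.
by rewrite ler_pM ?absval_ge0.
Qed.

Lemma near_root_sign (x : Kv) s :
  v (x - signed_root s) < v c -> (v (x - c) < v c) = s.
Proof.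
case: s => //= xc; apply/negbTE; rewrite -leNgt.
by rewrite (@abs_sum_near_root x (- c) false)//= subrr absval0.
Qed.

(** Subtracting the recurrences expresses the difference at [k], times a sum of size $|c|$, through
    the differences at $k\pm1$. Each use gains a factor [lam] and costs one index on either side. *)
Lemma code_agree_close p q N : J p -> J q ->
  (forall k, (`|k| < N)%N -> code p k = code q k) ->
  forall j k, (`|k| + j <= N)%N -> v (x_ k p - x_ k q) <= lam ^+ j * v c.
Proof.
move=> Jp Jq pq; elim=> [|j IH] k kN.
  by rewrite mul1r absB_le// julia_abs_le// ltW.
have kN' : (`|k| < N)%N by apply: leq_trans kN; rewrite addnS ltnS leq_addr.
have sum_c : v (x_ k p + x_ k q) = v c.
  apply: (@abs_sum_near_root _ _ (code p k)); first exact: code_near_root.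
  by rewrite pq//; exact: code_near_root.
have diff : (x_ k p - x_ k q) * (x_ k p + x_ k q) =
    b * (x_ (k - 1) p - x_ (k - 1) q) - 1 * (x_ (k + 1) p - x_ (k + 1) q).
  by rewrite !henon_iter_recurrence; ring.
rewrite -(ler_pM2r c_gt0) -{1}sum_c -absM diff.
have -> : lam ^+ j.+1 * v c * v c = rho * (lam ^+ j * v c).
  by rewrite -lamc exprS -mulrA mulrACA.
have IH1 : v (x_ (k - 1) p - x_ (k - 1) q) <= lam ^+ j * v c.
  by apply: IH; exact: absz_pred_add_le.
have IH2 : v (x_ (k + 1) p - x_ (k + 1) q) <= lam ^+ j * v c.
  by apply: IH; exact: absz_succ_add_le.
by apply: absB_le; rewrite absM ler_pM ?absval_ge0// absval1.
Qed.

Lemma code_agree_mdist p q N : J p -> J q ->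
  (forall k, (`|k| <= N)%N -> code p k = code q k) ->
  mdist p q <= lam ^+ N * v c.
Proof.
move=> Jp Jq pq; have close := code_agree_close (N := N.+1) Jp Jq pq.
have lamN : lam ^+ N.+1 * v c <= lam ^+ N * v c.
  by have /andP[lam0 lam1] := lam01; rewrite ler_wpM2r ?absval_ge0// ler_wiXn2l// ltW.
rewrite mdist_norm2 norm2_le /=; apply/andP; split.
  by apply: le_trans lamN; apply: (close _ 0).
(* The second coordinate has index $-1$, which leaves [N] contractions instead of [N.+1]. *)
have := close N (- 1)%R; rewrite -[(- 1)%R]sub0r -!henon_iter_snd.
by apply; exact: leqnn.
Qed.

Lemma code_inj p q : J p -> J q -> code p = code q -> p = q.
Proof.
move=> Jp Jq pq; apply: mdist_positivity; apply/eqP.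
rewrite eq_le mdist_ge0 andbT leNgt; apply/negP => /(exprn_cvg0 (v c) lam01)[N].
by apply/negP; rewrite -leNgt; apply: code_agree_mdist => // k _; rewrite pq.
Qed.

Lemma code_surj (s : bisequence R) : exists p, J p /\ code p = s.
Proof.
pose x0 k := signed_root (s k).
(* Newton's method for all equations of the recurrence at once, with the off-diagonal linear terms
   dropped from the derivative and its diagonal frozen at [2 * x0 k]. *)
pose F (x : int -> Kv) k : Kv :=
  x k - (x k ^+ 2 - a - b * x (k - 1) + x (k + 1)) / (2 * x0 k).
have v2x k : v (2 * x0 k) = v c by rewrite absM v2 mul1r abs_signed_root.
have x0n k : x0 k != 0 := signed_root_neq0 (s k).
have x0E k : a = x0 k ^+ 2 by rewrite signed_root_sqr.
have [x Dx||x Dx xF] :=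
  @uniform_fixed_point _ _ _ K_complete int F x0 rho lam lam01 rho_ge0.
- have xc k : v (x k) <= v c.
    rewrite -(subrK (x0 k) (x k)) absD_le ?abs_signed_root//.
    by apply: le_trans (ltW rho_c); exact: Dx.
  move=> k; have -> : F x k - x0 k =
      (b * x (k - 1) - 1 * x (k + 1) - (x k - x0 k) * (x k - x0 k)) / (2 * x0 k).
    by rewrite /F (x0E k); field; rewrite x0n.
  rewrite absf_div v2x ler_pdivrMr//.
  by apply: absB_le; [apply: absB_le|]; rewrite absM ler_pM ?absval_ge0 ?absval1// ?Dx//;
    exact: le_trans (Dx _) (ltW rho_c).
- move=> x y r Dx Dy xy k; have -> : F x k - F y k =
      (b * (x (k - 1) - y (k - 1)) - 1 * (x (k + 1) - y (k + 1))
       - ((x k - x0 k) + (y k - x0 k)) * (x k - y k)) / (2 * x0 k).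
    by rewrite /F; field; rewrite x0n.
  rewrite absf_div v2x ler_pdivrMr// mulrAC lamc.
  by apply: absB_le; [apply: absB_le|]; rewrite absM ler_pM ?absval_ge0 ?absval1//;
    apply: absD_le; [exact: Dx|exact: Dy].
(* At a fixed point the Newton correction vanishes, which is the Hénon recurrence. *)
have rec k : x (k + 1) = a + b * x (k - 1) - x k ^+ 2.
  have := congr1 (fun f => f k) xF; rewrite /F => /eqP.
  rewrite -subr_eq0 addrAC subrr sub0r oppr_eq0 mulf_eq0 invr_eq0 mulf_eq0.
  rewrite (negbTE two_neq0) (negbTE (x0n k)) !orbF => /eqP e.
  by rewrite -[LHS]subr0 -e; ring.
have orb := henon_iter_orbit rec.
have near k : v (x k - x0 k) < v c by apply: le_lt_trans rho_c; exact: Dx.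
have xc k : v (x k) <= v c.
  by rewrite -(subrK (x0 k) (x k)) absD_le ?abs_signed_root// ltW.
have orb_le k : norm2 (henon_iter a b k (x 0, x (- 1))) <= v c.
  by rewrite orb norm2_le /= !xc.
exists (x 0, x (- 1)); split.
  apply/(juliaP (ltW c1) (ltW bc) ar) => n.
  by rewrite -henon_iterN; split; [exact: (orb_le n)|exact: orb_le].
by apply/funext => k; rewrite /code orb; exact: near_root_sign (near k).
Qed.

Lemma code_shift p : code (H p) = two_sided_shift (code p).
Proof. by apply/funext => k; rewrite /two_sided_shift /code henon_iter_shift. Qed.

(** Points less than $|c|$ apart are both inside or both outside the open ball of radius $|c|$
    around $c$; this holds on the whole plane, not only on [J]. *)
Lemma near_code_eq p k : \forall q \near p, code q k = code p k.
Proof.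
have cx : {for p, continuous (fun q => x_ k q)}.
  apply: (@continuous_comp _ _ _ (henon_iter a b k) fst).
    exact: continuous_henon_iter.
  exact: cvg_fst.
have pU : nbhs p [set q | ball (x_ k p) (v c) (x_ k q)].
  by apply: cx; exact: nbhsx_ballx.
apply: filterS pU => q /=; rewrite ballEmdist /= mdist_absE => pq.
rewrite /code; apply/idP/idP => h.
  by rewrite -(subrKA (x_ k q)) absD_lt.
by rewrite -(subrKA (x_ k p)) absD_lt// abs_distC.
Qed.

Lemma near_code_agree p N :
  \forall q \near p, forall k, (`|k| <= N)%N -> code q k = code p k.
Proof.
elim: N => [|N IH].
  have := near_code_eq p 0; apply: filterS => q q0 k.
  by rewrite leqn0 absz_eq0 => /eqP ->.
near=> q => k; rewrite leq_eqVlt ltnS => /orP[/eqP kN|].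
  have [->|->] : k = N.+1%:Z \/ k = - N.+1%:Z by exact: absz_eq_cases.
    by near: q; exact: near_code_eq.
  by near: q; exact: near_code_eq.
by move: k; near: q.
Unshelve. all: by end_near. Qed.

Lemma continuous_code : continuous (code : Kv * Kv -> bisequence R).
Proof.
move=> p U /nbhs_mdistP[e e0 eU]; have [N Ne] := exists_expRN_lt e0.
have := near_code_agree p N; apply: filterS => q pq; apply: eU.
by apply: lt_trans Ne; apply/bidist_lt => k kN; rewrite pq.
Qed.

(** The conjugacy [w] is the inverse of [code] on [J]. It intertwines the maps because [code] does
    so and is injective on [J]; it is continuous because agreement on a long window forces
    closeness. *)
Lemma julia_conjugate_shift :
  conjugate_to_restriction (@two_sided_shift R) H J.
Proof.
have [w wP] := choice code_surj.
have Jw s : J (w s) := proj1 (wP s).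
have codeK s : code (w s) = s := proj2 (wP s).
have cw : continuous (w : bisequence R -> Kv * Kv).
  move=> s U /nbhs_mdistP[e e0 eU]; have [N Ne] := exprn_cvg0 (v c) lam01 e0.
  apply/nbhs_mdistP; exists (expR (- N%:R)); first exact: expR_gt0.
  move=> t /bidist_lt st; apply: eU; apply: le_lt_trans Ne.
  by apply: code_agree_mdist => // k kN; rewrite !codeK st.
exists (fun s => exist _ (w s) (mem_set (Jw s))); split; last first.
  move=> s; have : w (two_sided_shift s) = H (w s); last exact.
  apply: code_inj; [exact: Jw|exact/julia_henon/Jw|].
  by rewrite code_shift !codeK.
split.
  move=> s U [_ [[A oA <-] Aw AU]].
  apply: (@filterS _ (nbhs s) _ (w @^-1` A)).
    by move=> t At; apply: (AU (exist _ (w t) (mem_set (Jw t)))).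
  by apply: cw; exact: open_nbhs_nbhs.
exists (fun z => code (set_val z)); split.
- by move=> s; exact: codeK.
- move=> [p Jp]; apply: val_inj; have : w (code p) = p; last exact.
  by apply: code_inj; [exact: Jw|exact: set_mem Jp|exact: codeK].
- move=> z; apply: (@continuous_comp _ _ _ (set_val : J -> Kv * Kv) code).
    exact: initial_continuous.
  exact: continuous_code.
Qed.

End Coding.

End Dynamics.

(** * Assembly of the five statements *)

Theorem theorem1p1 (R : realType) (K : fieldType) (v : nonArchAbs R K)
    (v_nontrivial : exists x : K, x != 0 /\ v x != 1)
    (K_complete : complete_space (valued v))
    (K_locally_compact : locally_compact [set: valued v])
    (K_odd_residue_char :
      exists2 p : nat, odd p & p \in [pchar (residue_field v)])
    (a b : valued v) (ab_H : henon_param v (a, b)) :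
  [/\ compact (julia a b) /\
        (julia a b = set0 <-> region_III v (a, b) /\ ~ (exists c : valued v, a = c ^+ 2)),
      region_I v (a, b) <-> julia a b = cball v 1 (0, 0),
      (region_I v `|` region_II_plus v) (a, b) ->
        julia a b = [set p | recurrent (henon a b) p],
      region_II_plus v (a, b) -> attractor (henon a b) (julia a b) &
      region_III v (a, b) /\ (exists c : valued v, a = c ^+ 2) ->
        conjugate_to_restriction (@two_sided_shift R) (henon a b) (julia a b)].
Proof.
have b0 : b != 0 := ab_H.
have v2 := abs2_odd_residue K_odd_residue_char.
have shift_conj : region_III v (a, b) /\ (exists c : valued v, a = c ^+ 2) ->
    conjugate_to_restriction (@two_sided_shift R) (henon a b) (julia a b).
  rewrite /region_III /= gt_max => -[[_ /andP[a1 ba]] [c ac]].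
  have c1 : 1 < v c.
    by rewrite -(@ltr_pXn2r _ 2) ?nnegrE ?absval_ge0// expr1n -absX -ac.
  have bc : v b < v c.
    by rewrite -(@ltr_pXn2r _ 2) ?nnegrE ?absval_ge0// -[v c ^+ 2]absX -ac.
  exact: (julia_conjugate_shift b0 v2 K_complete ac c1 bc).
split=> //.
- split; first exact: compact_julia.
  split=> [J0|[III nsq]]; last first.
    apply/seteqP; split=> // p Jp; apply: nsq.
    exact: (region_III_julia_square b0 v2 K_complete III Jp).
  have noJ : ~ (julia a b !=set0) by rewrite J0 => -[].
  have III : region_III v (a, b).
    (* Outside region III, $|a|\le\max(1,|b|^2)$: the forward map preserves the unit ball if
       $|b|\le1$, and the inverse preserves the ball of radius $|b|$ otherwise. *)
    split=> //=; rewrite ltNge; apply/negP; rewrite le_max => aM; apply: noJ.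
    have [b1|b1] := leP (v b) 1; last first.
      apply: julia_neq0_of_large_b => //; first exact: ltW.
      by case/orP: aM => // /le_trans; apply; rewrite exprn_ege1// ltW.
    apply: julia_neq0_of_unit => //.
    by case/orP: aM => // /le_trans; apply; rewrite exprn_ile1// absval_ge0.
  (* If $a$ were a square, the conjugacy would send the constant bisequence to a point of [J]. *)
  split=> // sq; have [w _] := shift_conj (conj III sq).
  by apply: noJ; exists (set_val (w (fun=> true))); exact: set_valP.
- exact: region_I_julia_ball.
- move=> ab; have [a1 b1] : v a <= 1 /\ v b <= 1.
    by case: ab => -[_ /= [a1 b1]]; split; rewrite // ?b1// ltW.
  apply/seteqP; split=> p; first exact: julia_recurrent.
  exact: recurrent_julia.
- by move=> [_ /= [a1 b1]]; apply: julia_attractor => //; exact: ltW.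
Qed.
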